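(* Let $R\in(0,1)$ and let $N\geq 2$, $k\geq 1$ be integers. The function $T\mapsto\sigma_1(T)$ has exactly one zero $T_{1,*}$ in the interval $(0,\widehat T_k)$; this zero is simple, i.e. $\sigma_1'(T_{1,*})\neq 0$; and $\sigma_m(T_{1,*})\neq 0$ for every integer $m\geq 2$.
   Context: $A_R=\{x\in\mathbb{R}^N:R<|x|<1\}$. $\lambda_1<\lambda_2<\cdots$ are the eigenvalues of the regular Sturm--Liouville problem $-(r^{N-1}\phi')'=\lambda r^{N-1}\phi$ on $(R,1)$, $\phi(R)=\phi(1)=0$ (the radial Dirichlet eigenvalues of $A_R$). $\phi_k$ is the $k$th eigenfunction, viewed as the radial function $x\mapsto\phi_k(|x|)$ on $A_R$, normalized by $\int_{A_R}\phi_k^2\,dx=\frac{1}{2\pi}$ and $\phi_k'(1)<0$; $b_k:=-\phi_k'(1)>0$. The end of the first spectral gap is $\widehat T_k=+\infty$ if $k=1$ and $\widehat T_k=\frac{2\pi}{\sqrt{\lambda_k-\lambda_1}}$ if $k\geq 2$. For $T\in(0,\widehat T_k)$ and $m\geq 1$ put $\alpha_m(T)=\lambda_k-\left(\frac{2m\pi}{T}\right)^2$ (which is $<\lambda_1$), and let $c_m(\cdot;T)$ be the unique solution on $[R,1]$ of $$c_m''+\frac{N-1}{r}c_m'+\alpha_m(T)c_m=0,\qquad c_m(R;T)=0,\quad c_m(1;T)=b_k,$$ where primes denote $d/dr$. Define $\sigma_m(T)=c_m'(1;T)+\phi_k''(1)$. *)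

(* Defs.v *)
From Stdlib Require Export Reals.
From Coquelicot Require Export Coquelicot.
Open Scope R_scope.

(* Derivatives are taken relative to [a,1]: one-sided at the two endpoints. *)
Definition ival (a r : R) : Prop := a <= r <= 1.

Definition diff_on (a : R) (f : R -> R) : Prop :=
  forall r, ival a r -> exists l : R, D_in f (fun _ => l) (ival a) r.

(* For a < 1 such an l is unique, so der a f is the derivative of f wherever
   f is differentiable relative to [a,1]. *)
Definition der (a : R) (f : R -> R) (r : R) : R :=
  iota (fun l : R => D_in f (fun _ => l) (ival a) r).

Definition is_eigenfunction (N : nat) (a lam : R) (phi : R -> R) : Prop :=
  diff_on a phi /\
  diff_on a (fun r => r ^ (N - 1) * der a phi r) /\
  (forall r, a < r < 1 ->
     - der a (fun s => s ^ (N - 1) * der a phi s) r = lam * r ^ (N - 1) * phi r) /\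
  phi a = 0 /\ phi 1 = 0 /\
  (exists r, ival a r /\ phi r <> 0).

Definition is_eigenvalue (N : nat) (a lam : R) : Prop :=
  exists phi, is_eigenfunction N a lam phi.

(* lam 1 < lam 2 < ... lists all eigenvalues; lam 0 is unused. *)
Definition is_spectrum (N : nat) (a : R) (lam : nat -> R) : Prop :=
  (forall i j : nat, (1 <= i)%nat -> (i < j)%nat -> lam i < lam j) /\
  (forall mu : R,
     is_eigenvalue N a mu <-> exists j : nat, (1 <= j)%nat /\ mu = lam j).

(* Tn n R is R^n, as iterated pairs ending in tt. *)
Fixpoint sqnorm (n : nat) : Tn n R -> R :=
  match n with
  | O => fun _ => 0
  | S n' => fun x => fst x ^ 2 + sqnorm n' (snd x)
  end.

Definition enorm (n : nat) (x : Tn n R) : R := sqrt (sqnorm n x).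

(* Integral over [-1,1]^n as an iterated Riemann integral. *)
Fixpoint cube_int (n : nat) : (Tn n R -> R) -> R :=
  match n with
  | O => fun f => f tt
  | S n' => fun f => RInt (fun t => cube_int n' (fun x => f (t, x))) (-1) 1
  end.

(* Integral of u over {x in R^n : a < |x| < 1}: extend u by 0 to the cube.
   When u is continuous on the closed annulus and vanishes on its boundary, as
   below, the extension is continuous, so every iterated integral exists. *)
Definition annulus_int (n : nat) (a : R) (u : Tn n R -> R) : R :=
  cube_int n (fun x =>
    if Rlt_dec a (enorm n x) then
      if Rlt_dec (enorm n x) 1 then u x else 0
    else 0).

Definition is_normalized_eigenfunction
    (N : nat) (a lam : R) (phi : R -> R) : Prop :=
  is_eigenfunction N a lam phi /\
  annulus_int N a (fun x => phi (enorm N x) ^ 2) = 1 / (2 * PI) /\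
  der a phi 1 < 0.

Definition T_hat (lam : nat -> R) (k : nat) : Rbar :=
  match k with
  | 1%nat => p_infty
  | _ => Finite (2 * PI / sqrt (lam k - lam 1%nat))
  end.

Definition in_gap (lam : nat -> R) (k : nat) (T : R) : Prop :=
  0 < T /\ Rbar_lt (Finite T) (T_hat lam k).

Definition alpha (lam : nat -> R) (k m : nat) (T : R) : R :=
  lam k - (2 * INR m * PI / T) ^ 2.

Definition solves_c (N : nat) (a al b : R) (c : R -> R) : Prop :=
  diff_on a c /\ diff_on a (der a c) /\
  (forall r, ival a r ->
     der a (der a c) r + (INR N - 1) / r * der a c r + al * c r = 0) /\
  c a = 0 /\ c 1 = b.

(* c m T is the function r |-> c_m(r; T). *)
Definition Sigma (a : R) (phi : R -> R) (c : nat -> R -> R -> R)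
    (m : nat) (T : R) : R :=
  der a (c m T) 1 + der a (der a phi) 1.

(* Main.v *)
Require Import Defs.
From Stdlib Require Import Lra Lia Ranalysis5 Classical_Prop IndefiniteDescription.
Open Scope R_scope.

(** Write [a] for the inner radius, [L] for the first eigenvalue, [n = N - 1]
    and [b = - phi'(1)].  The equation of [phi] at [r = 1] gives
    [phi''(1) = n b].  For [al <= L] let [u al] be the solution of
    [u'' + (n/r) u' + al u = 0] with [u(a) = 0], [u'(a) = 1].  For [al < L] the
    Dirichlet problem is uniquely solvable, because [al] is not an eigenvalue, so
    [c_m(.; T)] is the multiple of [u al] with value [b] at [1], where
    [al = alpha_m(T)], and
<<
      sigma_m(T) = b * (s(alpha_m(T)) + n),     s(al) = u_al'(1) / u_al(1).
>>
    Everything follows from three facts about [s] on the half-line below [L].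

    - [s' < 0].  The Wronskian identity
      [u_al'(1) u_be(1) - u_al(1) u_be'(1) = (be - al) I(al, be)] with
      [I(al, be) = int_a^1 r^n u_al u_be dr] gives
      [s'(al) = - I(al, al) / u_al(1)^2] ([dtn_decreasing_derivative]); the only
      analysis needed is that [u_be] depends Lipschitz-continuously on [be]
      ([initial_value_lipschitz], by Gronwall).
    - [s(al) >= 0] when [al <= 0], since [r^n u u'] is then nondecreasing
      ([dtn_nonneg]).
    - [s] is unbounded below.  It decreases, so if it were bounded below it would
      be bounded near [L]; then [u_al'(1) = s(al) u_al(1)] would tend to [0] as
      [al] increases to [L], and [u_L] would have vanishing Cauchy data at [1]
      ([dtn_unbounded_below]).

    Hence [s] takes the value [- n] exactly once below [L], with nonzero
    derivative.  The map [alpha_1] is a strictly increasing bijection of the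
    spectral gap onto the half-line below [L], with positive derivative; this
    gives the simple unique zero of [sigma_1].  For [m >= 2],
    [alpha_m(T) < alpha_1(T)] makes [sigma_m] positive there. *)

(** * Derivatives relative to a closed interval *)

Lemma is_derive_D_in (a r l : R) (f g : R -> R) :
  ival a r -> (forall s, ival a s -> g s = f s) -> is_derive g r l ->
  D_in f (fun _ => l) (ival a) r.
Proof.
  intros Hr Hfg Hg.
  apply is_derive_Reals in Hg.
  intros eps Heps.
  destruct (Hg eps Heps) as [d Hd].
  exists d; split; [apply cond_pos|].
  intros x [[Hx Hne] Hdist]. simpl in *. unfold Rdist in *.
  rewrite <- !Hfg by assumption.
  replace (g x) with (g (r + (x - r))) by (f_equal; ring).
  apply Hd; [lra|assumption].
Qed.

Lemma D_in_unique (a r l l' : R) (f : R -> R) :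
  a < 1 -> ival a r ->
  D_in f (fun _ => l) (ival a) r -> D_in f (fun _ => l') (ival a) r -> l = l'.
Proof.
  intros Ha [Hr1 Hr2] H H'.
  refine (single_limit _ _ _ _ _ _ H H').
  intros e He. destruct (Rlt_dec r 1) as [Hlt|Hge].
  - exists (r + Rmin (e / 2) (1 - r)).
    assert (H1 := Rmin_l (e / 2) (1 - r)). assert (H2 := Rmin_r (e / 2) (1 - r)).
    assert (0 < Rmin (e / 2) (1 - r)) by (apply Rmin_glb_lt; lra).
    unfold D_x, ival, Rdist. rewrite Rabs_pos_eq; lra.
  - exists (r - Rmin (e / 2) (1 - a)).
    assert (H1 := Rmin_l (e / 2) (1 - a)). assert (H2 := Rmin_r (e / 2) (1 - a)).
    assert (0 < Rmin (e / 2) (1 - a)) by (apply Rmin_glb_lt; lra).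
    unfold D_x, ival, Rdist. rewrite Rabs_left; lra.
Qed.

Lemma der_unique (a r l : R) (f : R -> R) :
  a < 1 -> ival a r -> D_in f (fun _ => l) (ival a) r -> der a f r = l.
Proof.
  intros Ha Hr H. unfold der.
  apply (iota_unique (V := R_CompleteNormedModule)); [|exact H].
  intros y Hy. exact (D_in_unique _ _ _ _ _ Ha Hr Hy H).
Qed.

Lemma der_is_derive (a r l : R) (f g : R -> R) :
  a < 1 -> ival a r -> (forall s, ival a s -> g s = f s) -> is_derive g r l ->
  der a f r = l.
Proof. intros. eapply der_unique; eauto using is_derive_D_in. Qed.

Lemma der_D_in (a r : R) (f : R -> R) :
  a < 1 -> diff_on a f -> ival a r -> D_in f (fun _ => der a f r) (ival a) r.
Proof.
  intros Ha Hf Hr. destruct (Hf r Hr) as [l Hl].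
  now rewrite (der_unique _ _ _ _ Ha Hr Hl).
Qed.

(** A function differentiable relative to [[a,1]] extends to the line so that its
    relative derivative becomes an ordinary derivative at every point of [[a,1]],
    endpoints included.  The extension is affine outside [[a,1]]. *)
Lemma diff_on_extension (a : R) (f : R -> R) :
  a < 1 -> diff_on a f ->
  exists g, forall r, ival a r -> g r = f r /\ is_derive g r (der a f r).
Proof.
  intros Ha Hf.
  pose (cl := fun r => Rmax a (Rmin r 1)).
  assert (Hcl : forall r, ival a r -> cl r = r).
  { intros r [H1 H2]. unfold cl. rewrite Rmin_left, Rmax_right; lra. }
  exists (fun r => f (cl r) + der a f (cl r) * (r - cl r)).
  intros r Hr. assert (Hr' := Hr). destruct Hr' as [Hr1 Hr2]. split.
  - rewrite Hcl by assumption. ring.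
  - apply is_derive_Reals. intros eps Heps.
    (* The radius is also taken below [r - a] if [a < r] and below [1 - r] if
       [r < 1]: a step leaving [[a,1]] then starts from an endpoint, where the
       difference quotient is exactly the slope. *)
    destruct (der_D_in _ _ _ Ha Hf Hr eps Heps) as [d [Hd HD]].
    simpl in HD; unfold Rdist in HD.
    pose (d1 := if Rlt_dec a r then r - a else 1).
    pose (d2 := if Rlt_dec r 1 then 1 - r else 1).
    assert (Hpos : 0 < Rmin d (Rmin d1 d2)).
    { apply Rmin_glb_lt; [exact Hd|].
      apply Rmin_glb_lt;
        [unfold d1; destruct (Rlt_dec a r)|unfold d2; destruct (Rlt_dec r 1)]; lra. }
    exists (mkposreal _ Hpos). simpl. intros h Hh Hlt.
    assert (Hlt1 : Rabs h < d) by (eapply Rlt_le_trans; [exact Hlt|apply Rmin_l]).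
    assert (Hlt2 : Rabs h < d1).
    { eapply Rlt_le_trans; [exact Hlt|]. eapply Rle_trans; [apply Rmin_r|apply Rmin_l]. }
    assert (Hlt3 : Rabs h < d2).
    { eapply Rlt_le_trans; [exact Hlt|]. eapply Rle_trans; [apply Rmin_r|apply Rmin_r]. }
    rewrite (Hcl r Hr).
    destruct (Rlt_dec (r + h) a) as [Hl|Hl]; [|destruct (Rlt_dec 1 (r + h)) as [Hl'|Hl']].
    + assert (r = a).
      { unfold d1 in Hlt2. destruct (Rlt_dec a r); [|lra]. apply Rabs_def2 in Hlt2. lra. }
      subst r.
      assert (E : cl (a + h) = a) by (unfold cl; rewrite Rmin_left, Rmax_left; lra).
      rewrite E.
      match goal with |- Rabs ?e < _ => replace e with 0 by now field end.
      rewrite Rabs_R0. exact Heps.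
    + assert (r = 1).
      { unfold d2 in Hlt3. destruct (Rlt_dec r 1); [|lra]. apply Rabs_def2 in Hlt3. lra. }
      subst r.
      assert (E : cl (1 + h) = 1) by (unfold cl; rewrite Rmin_right, Rmax_right; lra).
      rewrite E.
      match goal with |- Rabs ?e < _ => replace e with 0 by now field end.
      rewrite Rabs_R0. exact Heps.
    + assert (Hrh : ival a (r + h)) by (unfold ival; lra).
      rewrite (Hcl _ Hrh).
      match goal with |- Rabs ?e < _ =>
        replace e with ((f (r + h) - f r) / (r + h - r) - der a f r) end.
      * apply HD. split; [split; [exact Hrh|lra]|].
        now replace (r + h - r) with h by ring.
      * field. lra.
Qed.

(** * Real functions of one variable *)

Lemma is_derive_continuity_pt (f : R -> R) (x l : R) :
  is_derive f x l -> continuity_pt f x.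
Proof.
  intro H. apply continuity_pt_filterlim, (ex_derive_continuous f). now exists l.
Qed.

Lemma mean_value (f df : R -> R) (a b : R) :
  a <= b -> (forall x, a <= x <= b -> is_derive f x (df x)) ->
  exists c, a <= c <= b /\ f b - f a = df c * (b - a).
Proof.
  intros Hab Hd.
  destruct (MVT_gen f a b df) as [c Hc].
  - rewrite Rmin_left, Rmax_right by lra. intros; apply Hd; lra.
  - rewrite Rmin_left, Rmax_right by lra. intros.
    eapply is_derive_continuity_pt, Hd; lra.
  - rewrite Rmin_left, Rmax_right in Hc by lra. now exists c.
Qed.

Lemma deriv_nonneg_le (f df : R -> R) (a b : R) :
  a <= b -> (forall x, a <= x <= b -> is_derive f x (df x)) ->
  (forall x, a <= x <= b -> 0 <= df x) -> f a <= f b.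
Proof.
  intros Hab Hd Hp. destruct (mean_value f df a b Hab Hd) as [c [Hc E]].
  specialize (Hp c Hc). nra.
Qed.

(** A derivative that agrees with a continuous function inside an interval
    agrees with it at the endpoints too. *)
Lemma derivative_closed_interval (f df k : R -> R) (a b : R) :
  a < b -> (forall x, a <= x <= b -> is_derive f x (df x)) ->
  (forall x, a < x < b -> df x = k x) ->
  (forall x, a <= x <= b -> continuity_pt k x) ->
  forall x, a <= x <= b -> df x = k x.
Proof.
  intros Hab Hd Hk Hc x Hx.
  apply cond_eq. intros eps Heps.
  assert (He : 0 < eps / 2) by lra.
  assert (Hdx := Hd x Hx). apply is_derive_Reals in Hdx.
  destruct (Hdx _ He) as [d Hd1].
  destruct (Hc x Hx _ He) as [d' [Hd' Hc1]]. simpl in Hc1; unfold Rdist in Hc1.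
  assert (Hdp := cond_pos d).
  assert (Hh : exists h, h <> 0 /\ Rabs h < d /\ Rabs h < d' /\ a <= x + h <= b).
  { set (e := Rmin (b - a) (Rmin d d') / 2).
    assert (M1 := Rmin_l (b - a) (Rmin d d')). assert (M2 := Rmin_r (b - a) (Rmin d d')).
    assert (M3 := Rmin_l d d'). assert (M4 := Rmin_r d d').
    assert (0 < Rmin (b - a) (Rmin d d')) by (repeat apply Rmin_glb_lt; lra).
    destruct (Rle_dec x ((a + b) / 2)).
    - exists e. unfold e. rewrite Rabs_pos_eq by lra. lra.
    - exists (- e). unfold e. rewrite Rabs_Ropp, Rabs_pos_eq by lra. lra. }
  destruct Hh as (h & H0 & H1 & H2 & H3).
  assert (Hmv : exists c, a < c < b /\ Rabs (c - x) < Rabs h /\ f (x + h) - f x = df c * h).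
  { destruct (Rtotal_order h 0) as [Hl|[Hl|Hl]]; [|lra|].
    - destruct (MVT_cor2 f df (x + h) x) as [c [E Hc2]]; [lra| |].
      + intros; apply is_derive_Reals, Hd; lra.
      + exists c. rewrite !Rabs_left by lra. split; [lra|split; [lra|]].
        replace h with (- (x - (x + h))) at 2 by ring. lra.
    - destruct (MVT_cor2 f df x (x + h)) as [c [E Hc2]]; [lra| |].
      + intros; apply is_derive_Reals, Hd; lra.
      + exists c. rewrite !Rabs_pos_eq by lra. split; [lra|split; [lra|]].
        rewrite E. ring. }
  destruct Hmv as (c & Hc2 & Hc3 & E).
  specialize (Hd1 h H0 H1). rewrite E, Hk in Hd1 by exact Hc2.
  replace (k c * h / h) with (k c) in Hd1 by (field; exact H0).
  destruct (Req_dec c x) as [->|Hne].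
  { rewrite Rabs_minus_sym in Hd1. lra. }
  assert (Q : Rabs (k c - k x) < eps / 2).
  { apply Hc1. split; [split; [exact I|lra]|lra]. }
  replace (df x - k x) with (- (k c - df x) + (k c - k x)) by ring.
  eapply Rle_lt_trans; [apply Rabs_triang|]. rewrite Rabs_Ropp. lra.
Qed.

Lemma lipschitz_at_continuity_pt (f : R -> R) (x C d : R) :
  0 < d -> (forall t, Rabs (t - x) < d -> Rabs (f t - f x) <= C * Rabs (t - x)) ->
  continuity_pt f x.
Proof.
  intros Hd H eps Heps.
  set (C' := Rabs C + 1).
  assert (HC : C <= C' /\ 0 < C').
  { unfold C'. assert (A := Rle_abs C). assert (B := Rabs_pos C). lra. }
  assert (Hq : 0 < eps / C') by (apply Rdiv_lt_0_compat; lra).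
  exists (Rmin d (eps / C')). split; [apply Rmin_glb_lt; assumption|].
  intros t [_ Ht]. simpl in *. unfold Rdist in *.
  assert (T1 := Rlt_le_trans _ _ _ Ht (Rmin_l _ _)).
  assert (T2 := Rlt_le_trans _ _ _ Ht (Rmin_r _ _)).
  specialize (H t T1). assert (Q := Rabs_pos (t - x)).
  assert (C' * Rabs (t - x) < eps).
  { apply Rmult_lt_reg_r with (/ C'); [apply Rinv_0_lt_compat; lra|].
    replace (C' * Rabs (t - x) * / C') with (Rabs (t - x)) by (field; lra). exact T2. }
  nra.
Qed.

(** Differentiability from a factorization of the increments of [f] at [x]
    through a function [q] continuous at [x]. *)
Lemma is_derive_of_slope (f q : R -> R) (x d : R) :
  0 < d -> (forall t, Rabs (t - x) < d -> f t - f x = (t - x) * q t) ->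
  continuity_pt q x -> is_derive f x (q x).
Proof.
  intros Hd H Hq. apply is_derive_Reals. intros eps Heps.
  destruct (Hq eps Heps) as [e [He HE]]. simpl in HE; unfold Rdist in HE.
  assert (Hp : 0 < Rmin d e) by (apply Rmin_glb_lt; assumption).
  exists (mkposreal _ Hp). simpl. intros h Hh Hlt.
  assert (T1 := Rlt_le_trans _ _ _ Hlt (Rmin_l _ _)).
  assert (T2 := Rlt_le_trans _ _ _ Hlt (Rmin_r _ _)).
  rewrite H by (now replace (x + h - x) with h by ring).
  replace ((x + h - x) * q (x + h) / h) with (q (x + h)) by (field; exact Hh).
  apply HE. split; [split; [exact I|lra]|now replace (x + h - x) with h by ring].
Qed.

(** * The radial initial value problem *)

(** Gronwall's inequality, proved by monotonicity of
    [(E + m/K) exp (- K (x - a))]. *)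
Lemma gronwall (E dE : R -> R) (a b K m : R) :
  a <= b -> 0 < K ->
  (forall x, a <= x <= b -> is_derive E x (dE x)) ->
  (forall x, a <= x <= b -> dE x <= K * E x + m) ->
  E b + m / K <= (E a + m / K) * exp (K * (b - a)).
Proof.
  intros Hab HK Hd Hle.
  set (F := fun x => - ((E x + m / K) * exp (- K * (x - a)))).
  assert (H : F a <= F b).
  { apply (deriv_nonneg_le F
      (fun x => (K * E x + m - dE x) * exp (- K * (x - a)))); [exact Hab| |].
    - intros x Hx. unfold F. specialize (Hd x Hx).
      auto_derive; [now exists (dE x)|].
      rewrite (is_derive_unique (fun x0 : R => E x0) _ _ Hd).
      unfold Rminus. field. lra.
    - intros x Hx. specialize (Hle x Hx).
      apply Rmult_le_pos; [lra|left; apply exp_pos]. }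
  unfold F in H. replace (- K * (a - a)) with 0 in H by ring. rewrite exp_0 in H.
  assert (E0 : exp (- K * (b - a)) * exp (K * (b - a)) = 1).
  { rewrite <- exp_plus. replace (_ + _) with 0 by ring. apply exp_0. }
  assert (P := exp_pos (K * (b - a))).
  set (e1 := exp (- K * (b - a))) in *. set (e2 := exp (K * (b - a))) in *.
  assert ((E b + m / K) * e1 <= E a + m / K) by lra.
  apply (Rmult_le_compat_r e2) in H0; [|lra].
  rewrite Rmult_assoc, E0 in H0. lra.
Qed.

(** Gronwall's inequality for [y^2 + z^2] along the equation with forcing term
    [f].  The singular term [- (nu/r) z] only lowers the energy. *)
Lemma energy_bound (a nu al K m : R) (y z f : R -> R) :
  0 < a -> 0 <= nu -> Rabs al + 2 <= K -> 0 <= m ->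
  (forall r, a <= r <= 1 -> is_derive y r (z r) /\
     is_derive z r (- (nu / r) * z r - al * y r + f r)) ->
  (forall r, a <= r <= 1 -> f r ^ 2 <= m) ->
  forall r, a <= r <= 1 ->
    y r ^ 2 + z r ^ 2 <= (y a ^ 2 + z a ^ 2 + m) * exp K.
Proof.
  intros Ha Hnu HK Hm Hd Hf r Hr.
  assert (HK2 : 2 <= K) by (assert (Q := Rabs_pos al); lra).
  assert (G := gronwall (fun x => y x ^ 2 + z x ^ 2)
    (fun x => 2 * y x * z x + 2 * z x * (- (nu / x) * z x - al * y x + f x))
    a r K m).
  cbv beta in G.
  assert (H : y r ^ 2 + z r ^ 2 + m / K <=
      (y a ^ 2 + z a ^ 2 + m / K) * exp (K * (r - a))).
  { apply G; [lra|lra| |].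
    - intros x Hx. destruct (Hd x ltac:(lra)) as [Hy Hz].
      auto_derive; [repeat split; eexists; eassumption|].
      rewrite (is_derive_unique (fun x0 : R => y x0) _ _ Hy).
      rewrite (is_derive_unique (fun x0 : R => z x0) _ _ Hz).
      ring.
    - intros x Hx. specialize (Hf x ltac:(lra)).
      assert (0 <= nu / x) by (apply Rdiv_le_0_compat; lra).
      assert (Q1 : 0 <= nu / x * z x ^ 2) by (apply Rmult_le_pos; [lra|apply pow2_ge_0]).
      assert (Q2 : - 2 * al * (y x * z x) <= Rabs al * (y x ^ 2 + z x ^ 2)).
      { assert (A := Rle_abs al). assert (A' := Rle_abs (- al)). rewrite Rabs_Ropp in A'.
        assert (B1 := pow2_ge_0 (y x + z x)). assert (B2 := pow2_ge_0 (y x - z x)).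
        nra. }
      assert (B2 := pow2_ge_0 (y x - z x)). assert (B3 := pow2_ge_0 (z x - f x)).
      assert (B4 := pow2_ge_0 (y x)). assert (B5 := pow2_ge_0 (z x)).
      assert ((Rabs al + 2) * (y x ^ 2 + z x ^ 2) <= K * (y x ^ 2 + z x ^ 2)) by nra.
      nra. }
  assert (He : exp (K * (r - a)) <= exp K).
  { destruct (Req_dec (K * (r - a)) K) as [->|Hne]; [lra|].
    left. apply exp_increasing. nra. }
  assert (Hmk : 0 <= m / K <= m).
  { split; [apply Rdiv_le_0_compat; lra|].
    apply Rmult_le_reg_r with K; [lra|]. unfold Rdiv. rewrite Rmult_assoc, Rinv_l by lra. nra. }
  assert (B4 := pow2_ge_0 (y a)). assert (B5 := pow2_ge_0 (z a)).
  assert (P := exp_pos (K * (r - a))).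
  assert ((y a ^ 2 + z a ^ 2 + m / K) * exp (K * (r - a)) <=
          (y a ^ 2 + z a ^ 2 + m) * exp K) by (apply Rmult_le_compat; lra).
  lra.
Qed.

(** [y] solves [y'' + (nu/r) y' + al y = 0] on [[a,1]] and [z] is its derivative.
    The derivatives are two-sided also at the endpoints, so [y] and [z] are
    understood as extended beyond [[a,1]]. *)
Definition radial_solution (a nu al : R) (y z : R -> R) : Prop :=
  forall r, a <= r <= 1 ->
    is_derive y r (z r) /\ is_derive z r (- (nu / r) * z r - al * y r).

Lemma radial_solution_bound (a nu al K : R) (y z : R -> R) :
  0 < a -> 0 <= nu -> Rabs al + 2 <= K -> radial_solution a nu al y z ->
  forall r, a <= r <= 1 ->
    y r ^ 2 + z r ^ 2 <= (y a ^ 2 + z a ^ 2) * exp K.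
Proof.
  intros Ha Hnu HK Hs r Hr.
  rewrite <- (Rplus_0_r (y a ^ 2 + z a ^ 2)).
  apply (energy_bound a nu al K 0 y z (fun _ => 0)); try assumption; try lra.
  - intros s Hs'. destruct (Hs s Hs'). rewrite Rplus_0_r. now split.
  - intros; lra.
Qed.

Lemma radial_solution_zero (a nu al : R) (y z : R -> R) :
  0 < a -> 0 <= nu -> radial_solution a nu al y z ->
  y a = 0 -> z a = 0 -> forall r, a <= r <= 1 -> y r = 0.
Proof.
  intros Ha Hnu Hs Hy Hz r Hr.
  assert (H := radial_solution_bound a nu al _ y z Ha Hnu (Rle_refl _) Hs r Hr).
  rewrite Hy, Hz in H. assert (B4 := pow2_ge_0 (y r)). assert (B5 := pow2_ge_0 (z r)).
  replace ((0 ^ 2 + 0 ^ 2) * exp (Rabs al + 2)) with 0 in H by ring. nra.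
Qed.

Lemma radial_solution_lin (a nu al s t : R) (y1 z1 y2 z2 : R -> R) :
  radial_solution a nu al y1 z1 -> radial_solution a nu al y2 z2 ->
  radial_solution a nu al (fun r => s * y1 r + t * y2 r) (fun r => s * z1 r + t * z2 r).
Proof.
  intros H1 H2 r Hr. destruct (H1 r Hr) as [A1 B1], (H2 r Hr) as [A2 B2].
  split.
  - apply (is_derive_plus (fun r => s * y1 r) (fun r => t * y2 r));
      now apply is_derive_scal.
  - replace (- (nu / r) * (s * z1 r + t * z2 r) - al * (s * y1 r + t * y2 r))
      with (plus (s * (- (nu / r) * z1 r - al * y1 r)) (t * (- (nu / r) * z2 r - al * y2 r)))
      by (unfold plus; simpl; ring).
    apply (is_derive_plus (fun r => s * z1 r) (fun r => t * z2 r));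
      now apply is_derive_scal.
Qed.

(** The solution of an initial value problem depends on the spectral parameter in
    a Lipschitz way, uniformly on [[a,1]]: the difference of two solutions solves
    the equation with forcing term [(al - be) y] and zero initial data. *)
Lemma initial_value_lipschitz (a nu al B : R) (y z : R -> R) :
  0 < a -> 0 <= nu -> radial_solution a nu al y z ->
  exists C, 0 <= C /\ forall be y' z', Rabs be <= B ->
    radial_solution a nu be y' z' -> y' a = y a -> z' a = z a ->
    forall r, a <= r <= 1 ->
      Rabs (y' r - y r) <= C * Rabs (be - al) /\
      Rabs (z' r - z r) <= C * Rabs (be - al).
Proof.
  intros Ha Hnu Hs.
  set (M := (y a ^ 2 + z a ^ 2) * exp (Rabs al + 2)).
  assert (HM : 0 <= M).
  { apply Rmult_le_pos; [|left; apply exp_pos].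
    assert (B4 := pow2_ge_0 (y a)). assert (B5 := pow2_ge_0 (z a)). lra. }
  set (C2 := M * exp (B + 2)).
  assert (HC2 : 0 <= C2) by (apply Rmult_le_pos; [lra|left; apply exp_pos]).
  exists (sqrt C2). split; [apply sqrt_pos|].
  intros be y' z' HB Hs' Ey Ez r Hr.
  assert (Hy : forall s, a <= s <= 1 -> y s ^ 2 <= M).
  { intros s Hs1.
    assert (Q := radial_solution_bound a nu al _ y z Ha Hnu (Rle_refl _) Hs s Hs1).
    fold M in Q. assert (B5 := pow2_ge_0 (z s)). lra. }
  assert (H : (y' r - y r) ^ 2 + (z' r - z r) ^ 2 <=
     ((y' a - y a) ^ 2 + (z' a - z a) ^ 2 + (be - al) ^ 2 * M) * exp (B + 2)).
  { apply (energy_bound a nu be (B + 2) ((be - al) ^ 2 * M)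
      (fun r => y' r - y r) (fun r => z' r - z r) (fun r => (al - be) * y r));
      try assumption; try lra.
    - apply Rmult_le_pos; [apply pow2_ge_0|lra].
    - intros s Hs1. destruct (Hs s Hs1) as [A1 B1], (Hs' s Hs1) as [A2 B2]. split.
      + now apply (is_derive_minus y' y).
      + replace (- (nu / s) * (z' s - z s) - be * (y' s - y s) + (al - be) * y s)
          with (minus (- (nu / s) * z' s - be * y' s) (- (nu / s) * z s - al * y s))
          by (unfold minus, plus, opp; simpl; ring).
        now apply (is_derive_minus z' z).
    - intros s Hs1. specialize (Hy s Hs1).
      replace (((al - be) * y s) ^ 2) with ((be - al) ^ 2 * y s ^ 2) by ring.
      apply Rmult_le_compat_l; [apply pow2_ge_0|exact Hy]. }
  rewrite Ey, Ez in H. rewrite !Rminus_diag in H by reflexivity.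
  replace ((0 ^ 2 + 0 ^ 2 + (be - al) ^ 2 * M) * exp (B + 2))
    with (C2 * (be - al) ^ 2) in H by (unfold C2; ring).
  assert (B4 := pow2_ge_0 (y' r - y r)). assert (B5 := pow2_ge_0 (z' r - z r)).
  assert (Hroot : forall t, t ^ 2 <= C2 * (be - al) ^ 2 -> Rabs t <= sqrt C2 * Rabs (be - al)).
  { intros t Ht. rewrite <- !sqrt_Rsqr_abs, <- sqrt_mult;
      [|exact HC2|apply Rle_0_sqr].
    apply sqrt_le_1_alt. unfold Rsqr. simpl in Ht. lra. }
  split; apply Hroot; lra.
Qed.

(** * The weighted Wronskian identity *)

Lemma is_derive_weight (n : nat) (r : R) :
  0 < r -> is_derive (fun s => s ^ n) r (INR n / r * r ^ n).
Proof.
  intros Hr. auto_derive; [exact I|].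
  destruct n as [|n]; [simpl; unfold Rdiv; ring|].
  simpl pred. rewrite <- tech_pow_Rmult. field. lra.
Qed.

Lemma radial_solution_continuous (a nu al : R) (y z : R -> R) :
  radial_solution a nu al y z ->
  forall r, a <= r <= 1 -> continuous y r.
Proof.
  intros H r Hr. apply (ex_derive_continuous (K := R_AbsRing) (V := R_NormedModule)).
  eexists. apply (H r Hr).
Qed.

Lemma continuous_weighted (a : R) (n : nat) (y1 y2 : R -> R) (r : R) :
  0 < a <= r -> continuous y1 r -> continuous y2 r ->
  continuous (fun s => s ^ n * (y1 s * y2 s)) r.
Proof.
  intros Hr H1 H2.
  apply (continuous_mult (fun s => s ^ n) (fun s => y1 s * y2 s)).
  - apply (ex_derive_continuous (fun s : R => s ^ n)).
    eexists. apply is_derive_weight. lra.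
  - now apply (continuous_mult y1 y2).
Qed.

Lemma ex_RInt_weighted (a : R) (n : nat) (y1 y2 : R -> R) :
  0 < a < 1 -> (forall r, a <= r <= 1 -> continuous y1 r) ->
  (forall r, a <= r <= 1 -> continuous y2 r) ->
  ex_RInt (fun r => r ^ n * (y1 r * y2 r)) a 1.
Proof.
  intros Ha H1 H2. apply (ex_RInt_continuous (V := R_CompleteNormedModule)).
  rewrite Rmin_left, Rmax_right by lra. intros r Hr.
  apply (continuous_weighted a); [lra|apply H1|apply H2]; exact Hr.
Qed.

(** The derivative of [r^n (y1' y2 - y1 y2')] is [(be - al) r^n y1 y2], and this
    weighted Wronskian vanishes at [a]. *)
Lemma wronskian_identity (a al be : R) (n : nat) (y1 z1 y2 z2 : R -> R) :
  0 < a < 1 ->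
  radial_solution a (INR n) al y1 z1 -> radial_solution a (INR n) be y2 z2 ->
  y1 a = 0 -> y2 a = 0 ->
  z1 1 * y2 1 - y1 1 * z2 1 = (be - al) * RInt (fun r => r ^ n * (y1 r * y2 r)) a 1.
Proof.
  intros Ha H1 H2 E1 E2.
  assert (Hc1 := radial_solution_continuous _ _ _ _ _ H1).
  assert (Hc2 := radial_solution_continuous _ _ _ _ _ H2).
  assert (HI : is_RInt (fun r => (be - al) * (r ^ n * (y1 r * y2 r))) a 1
     (minus (1 ^ n * (z1 1 * y2 1 - y1 1 * z2 1)) (a ^ n * (z1 a * y2 a - y1 a * z2 a)))).
  { apply (is_RInt_derive (V := R_CompleteNormedModule)
      (fun r => r ^ n * (z1 r * y2 r - y1 r * z2 r))).
    - rewrite Rmin_left, Rmax_right by lra. intros r Hr.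
      destruct (H1 r Hr) as [A1 B1], (H2 r Hr) as [A2 B2].
      assert (P := is_derive_weight n r ltac:(lra)).
      apply is_derive_Reals in A1, B1, A2, B2, P. apply is_derive_Reals.
      assert (D := derivable_pt_lim_mult _ _ _ _ _ P
        (derivable_pt_lim_minus _ _ _ _ _
          (derivable_pt_lim_mult _ _ _ _ _ B1 A2)
          (derivable_pt_lim_mult _ _ _ _ _ A1 B2))).
      unfold mult_fct, minus_fct in D.
      match type of D with derivable_pt_lim _ _ ?l =>
        replace ((be - al) * (r ^ n * (y1 r * y2 r))) with l end; [exact D|].
      field. lra.
    - rewrite Rmin_left, Rmax_right by lra. intros r Hr.
      apply (continuous_scal_r (be - al) (fun r => r ^ n * (y1 r * y2 r))).
      apply (continuous_weighted a); [lra|auto|auto]. }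
  apply (is_RInt_unique (V := R_CompleteNormedModule)) in HI.
  rewrite (RInt_scal (V := R_CompleteNormedModule)) in HI by now apply ex_RInt_weighted.
  unfold scal, minus, plus, opp in HI; simpl in HI; unfold mult in HI; simpl in HI.
  rewrite HI, pow1, E1, E2. ring.
Qed.

(** Nonvanishing of [y] at the endpoint [1] is enough: the integrand is then
    positive near [1]. *)
Lemma weighted_square_pos (a : R) (n : nat) (y : R -> R) :
  0 < a < 1 -> (forall r, a <= r <= 1 -> continuous y r) -> y 1 <> 0 ->
  0 < RInt (fun r => r ^ n * (y r * y r)) a 1.
Proof.
  intros Ha Hc H1.
  assert (Hn : locally 1 (fun r => y r <> 0)).
  { apply (Hc 1 ltac:(lra) (fun t => t <> 0)). now apply open_neq. }
  destruct Hn as [d Hd].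
  set (x := Rmax a (1 - d / 2)).
  assert (Hdp := cond_pos d).
  assert (Hx : a <= x < 1).
  { unfold x. split; [apply Rmax_l|]. apply Rmax_lub_lt; lra. }
  assert (Hx' : 1 - d / 2 <= x) by apply Rmax_r.
  assert (Hcw : forall r, a <= r <= 1 -> continuous (fun r => r ^ n * (y r * y r)) r).
  { intros r Hr. apply (continuous_weighted a); [lra|auto|auto]. }
  assert (Hex : forall u v, a <= u -> u <= v -> v <= 1 ->
    ex_RInt (fun r => r ^ n * (y r * y r)) u v).
  { intros u v Hu Huv Hv. apply (ex_RInt_continuous (V := R_CompleteNormedModule)).
    rewrite Rmin_left, Rmax_right by lra. intros; apply Hcw; lra. }
  rewrite <- (RInt_Chasles _ a x 1) by (apply Hex; lra).
  apply Rplus_le_lt_0_compat.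
  - apply RInt_ge_0; [lra|apply Hex; lra|]. intros r Hr.
    apply Rmult_le_pos; [apply pow_le; lra|apply Rle_0_sqr].
  - apply RInt_gt_0; [lra| |intros; apply Hcw; lra]. intros r Hr.
    apply Rmult_lt_0_compat; [apply pow_lt; lra|].
    apply Rsqr_pos_lt, Hd. unfold ball; simpl; unfold AbsRing_ball, abs, minus, plus, opp; simpl.
    rewrite Rabs_left; lra.
Qed.

(** * The Dirichlet-to-Neumann function *)

(** For each [al <= L], [u al] is the solution with value [0] and slope [1] at
    [a], and [v al] is its derivative.  The conditions at [1] say that [L] is a
    Dirichlet eigenvalue and that no smaller number is one. *)
Definition shooting_family (a : R) (n : nat) (L : R) (u v : R -> R -> R) : Prop :=
  (forall al, al <= L -> radial_solution a (INR n) al (u al) (v al)) /\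
  (forall al, al <= L -> u al a = 0) /\
  (forall al, al <= L -> v al a = 1) /\
  (forall al, al < L -> u al 1 <> 0) /\
  u L 1 = 0.

(** Nontrivial solutions vanishing at [a] can be rescaled to slope [1] at [a]:
    a zero slope there would make them vanish identically. *)
Lemma shooting_family_exists (a : R) (n : nat) (L : R) :
  0 < a < 1 ->
  (forall al, al <= L -> exists y z, radial_solution a (INR n) al y z /\ y a = 0 /\
     (exists r, a <= r <= 1 /\ y r <> 0) /\
     (al < L -> y 1 <> 0) /\ (al = L -> y 1 = 0)) ->
  exists u v, shooting_family a n L u v.
Proof.
  intros Ha H.
  assert (H' : forall al, exists p : (R -> R) * (R -> R), al <= L ->
     radial_solution a (INR n) al (fst p) (snd p) /\ fst p a = 0 /\ snd p a = 1 /\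
     (al < L -> fst p 1 <> 0) /\ (al = L -> fst p 1 = 0)).
  { intros al. destruct (Rle_dec al L) as [Hle|Hle].
    2: { exists (fun _ => 0, fun _ => 0). intros Hc; contradiction. }
    destruct (H al Hle) as (y & z & Hs & Hy & [r [Hr Hr']] & Hlt & Heq).
    assert (Hz : z a <> 0).
    { intros Hz. apply Hr'.
      exact (radial_solution_zero a _ al y z ltac:(lra) (pos_INR n) Hs Hy Hz r Hr). }
    exists (fun r => / z a * y r + 0 * y r, fun r => / z a * z r + 0 * z r).
    intros _. simpl. split; [now apply radial_solution_lin|].
    rewrite Hy. split; [ring|]. split; [field; exact Hz|]. split.
    - intros Hl. rewrite Rmult_0_l, Rplus_0_r.
      apply Rmult_integral_contrapositive. split; [now apply Rinv_neq_0_compat|auto].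
    - intros El. rewrite (Heq El). ring. }
  destruct (functional_choice _ H') as [p Hp].
  exists (fun al => fst (p al)), (fun al => snd (p al)).
  split; [|split; [|split; [|split]]]; [intros al Hal; now apply Hp..| |].
  - intros al Hal. apply Hp; lra.
  - apply Hp; lra.
Qed.

Section DirichletNeumann.

Context (a : R) (n : nat) (L : R) (u v : R -> R -> R).
Context (Ha : 0 < a < 1) (Huv : shooting_family a n L u v).

Lemma family_solution (al : R) : al <= L -> radial_solution a (INR n) al (u al) (v al).
Proof. apply Huv. Qed.

Lemma family_value_a (al : R) : al <= L -> u al a = 0.
Proof. apply Huv. Qed.

Lemma family_slope_a (al : R) : al <= L -> v al a = 1.
Proof. apply Huv. Qed.

Lemma family_value_1 (al : R) : al < L -> u al 1 <> 0.
Proof. apply Huv. Qed.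

Lemma family_value_1_critical : u L 1 = 0.
Proof. apply Huv. Qed.

Lemma family_lipschitz (al : R) : al <= L ->
  exists C, 0 <= C /\ forall be, be <= L -> Rabs (be - al) < 1 ->
    forall r, a <= r <= 1 ->
      Rabs (u be r - u al r) <= C * Rabs (be - al) /\
      Rabs (v be r - v al r) <= C * Rabs (be - al).
Proof.
  intros Hal.
  destruct (initial_value_lipschitz a (INR n) al (Rabs al + 1) (u al) (v al))
    as [C [HC H]]; [lra|apply pos_INR|now apply family_solution|].
  exists C. split; [exact HC|]. intros be Hbe Hd. apply H.
  - assert (Q := Rabs_triang_inv be al). lra.
  - now apply family_solution.
  - now rewrite !family_value_a.
  - now rewrite !family_slope_a.
Qed.

Lemma pairing_continuous (al : R) : al < L ->
  continuity_pt (fun be => RInt (fun r => r ^ n * (u al r * u be r)) a 1) al.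
Proof.
  intros Hal.
  destruct (family_lipschitz al) as [C [HC H]]; [lra|].
  assert (Hb := radial_solution_bound a (INR n) al _ _ _ ltac:(lra) (pos_INR n)
                  (Rle_refl _) (family_solution al ltac:(lra))).
  rewrite family_value_a, family_slope_a in Hb by lra.
  set (M := (0 ^ 2 + 1 ^ 2) * exp (Rabs al + 2)) in Hb.
  assert (Hm : 0 < Rmin 1 (L - al)) by (apply Rmin_glb_lt; lra).
  apply (lipschitz_at_continuity_pt _ al ((1 - a) * (sqrt M * C)) _ Hm).
  intros be Hbe.
  assert (T1 := Rlt_le_trans _ _ _ Hbe (Rmin_l _ _)).
  assert (T2 := Rlt_le_trans _ _ _ Hbe (Rmin_r _ _)).
  assert (HbL : be <= L) by (apply Rabs_def2 in T2; lra).
  assert (Hcu : forall g, g <= L -> forall r, a <= r <= 1 -> continuous (u g) r).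
  { intros g Hg r Hr.
    exact (radial_solution_continuous _ _ _ _ _ (family_solution g Hg) r Hr). }
  assert (Hx1 := ex_RInt_weighted a n (u al) (u be) Ha (Hcu al ltac:(lra)) (Hcu be HbL)).
  assert (Hx2 := ex_RInt_weighted a n (u al) (u al) Ha (Hcu al ltac:(lra)) (Hcu al ltac:(lra))).
  rewrite <- (RInt_minus (V := R_CompleteNormedModule) _ _ a 1 Hx1 Hx2
                : _ = RInt _ a 1 - RInt _ a 1).
  rewrite Rmult_assoc. apply abs_RInt_le_const; [lra| |].
  { now apply (ex_RInt_minus (V := R_NormedModule)). }
  intros r Hr. unfold minus, plus, opp; simpl.
  replace (r ^ n * (u al r * u be r) + - (r ^ n * (u al r * u al r)))
    with (r ^ n * (u al r * (u be r - u al r))) by ring.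
  destruct (H be HbL T1 r Hr) as [Hd _].
  assert (Hur : Rabs (u al r) <= sqrt M).
  { rewrite <- sqrt_Rsqr_abs. apply sqrt_le_1_alt. specialize (Hb r Hr).
    assert (Q := pow2_ge_0 (v al r)). unfold Rsqr. lra. }
  assert (Hrn : 0 <= r ^ n <= 1).
  { split; [apply pow_le; lra|]. rewrite <- (pow1 n). apply pow_incr. lra. }
  rewrite !Rabs_mult, (Rabs_pos_eq (r ^ n)) by lra.
  assert (0 <= Rabs (u al r) * Rabs (u be r - u al r)) by (apply Rmult_le_pos; apply Rabs_pos).
  assert (Rabs (u al r) * Rabs (u be r - u al r) <= sqrt M * (C * Rabs (be - al))).
  { apply Rmult_le_compat; try apply Rabs_pos; assumption. }
  nra.
Qed.

(** The logarithmic derivative at [1] of the solution vanishing at [a], that is,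
    the normal derivative at [r = 1] of the radial solution with boundary values
    [0] at [a] and [1] at [1]. *)
Definition dtn (al : R) : R := v al 1 / u al 1.

Lemma dtn_decreasing_derivative (al : R) : al < L ->
  exists d, d < 0 /\ is_derive dtn al d.
Proof.
  intros Hal.
  set (q := fun be => - (RInt (fun r => r ^ n * (u al r * u be r)) a 1 * / (u al 1 * u be 1))).
  exists (q al). split.
  - unfold q. apply Ropp_lt_gt_0_contravar, Rmult_lt_0_compat.
    + apply weighted_square_pos; [exact Ha| |now apply family_value_1].
      intros r Hr.
      exact (radial_solution_continuous _ _ _ _ _ (family_solution al ltac:(lra)) r Hr).
    + apply Rinv_0_lt_compat. apply Rsqr_pos_lt. now apply family_value_1.
  - apply (is_derive_of_slope dtn q al (L - al)); [lra| |].
    + intros be Hbe. apply Rabs_def2 in Hbe.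
      assert (W := wronskian_identity a al be n _ _ _ _ Ha
        (family_solution al ltac:(lra)) (family_solution be ltac:(lra))
        (family_value_a al ltac:(lra)) (family_value_a be ltac:(lra))).
      assert (N1 := family_value_1 al Hal). assert (N2 := family_value_1 be ltac:(lra)).
      unfold dtn, q.
      replace ((be - al) *
        - (RInt (fun r : R => r ^ n * (u al r * u be r)) a 1 * / (u al 1 * u be 1)))
        with (- ((be - al) * RInt (fun r : R => r ^ n * (u al r * u be r)) a 1)
              * / (u al 1 * u be 1)) by ring.
      rewrite <- W. field. now split.
    + apply continuity_pt_opp, continuity_pt_mult; [now apply pairing_continuous|].
      apply continuity_pt_inv;
        [|apply Rmult_integral_contrapositive; split; now apply family_value_1].
      apply continuity_pt_mult; [apply continuity_pt_const; intros s t; reflexivity|].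
      destruct (family_lipschitz al) as [C [HC H]]; [lra|].
      apply (lipschitz_at_continuity_pt _ al C (Rmin 1 (L - al))); [apply Rmin_glb_lt; lra|].
      intros be Hbe.
      assert (T1 := Rlt_le_trans _ _ _ Hbe (Rmin_l _ _)).
      assert (T2 := Rlt_le_trans _ _ _ Hbe (Rmin_r _ _)).
      apply Rabs_def2 in T2. apply H; lra.
Qed.

Lemma dtn_decreasing (al be : R) : al < be -> be < L -> dtn be < dtn al.
Proof.
  intros Hab Hb.
  destruct (mean_value dtn (Derive dtn) al be) as [g [Hg E]]; [lra| |].
  - intros g Hg. destruct (dtn_decreasing_derivative g) as [d [_ Hd]]; [lra|].
    now rewrite (is_derive_unique _ _ _ Hd).
  - destruct (dtn_decreasing_derivative g) as [d [Hneg Hd]]; [lra|].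
    rewrite (is_derive_unique _ _ _ Hd) in E. nra.
Qed.

(** For [al <= 0] the function [r^n u u'] has derivative
    [r^n (u'^2 - al u^2) >= 0] and vanishes at [a]. *)
Lemma dtn_nonneg (al : R) : al < L -> al <= 0 -> 0 <= dtn al.
Proof.
  intros Hal Hneg.
  assert (H : a ^ n * (u al a * v al a) <= 1 ^ n * (u al 1 * v al 1)).
  { apply (deriv_nonneg_le (fun r => r ^ n * (u al r * v al r))
      (fun r => r ^ n * (v al r ^ 2 - al * u al r ^ 2))); [lra| |].
    - intros r Hr. destruct (family_solution al ltac:(lra) r Hr) as [A B].
      assert (P := is_derive_weight n r ltac:(lra)).
      apply is_derive_Reals in A, B, P. apply is_derive_Reals.
      assert (D := derivable_pt_lim_mult _ _ _ _ _ P
        (derivable_pt_lim_mult _ _ _ _ _ A B)).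
      unfold mult_fct in D.
      match type of D with derivable_pt_lim _ _ ?l =>
        replace (r ^ n * (v al r ^ 2 - al * u al r ^ 2)) with l end; [exact D|].
      field. lra.
    - intros r Hr. apply Rmult_le_pos; [apply pow_le; lra|].
      assert (Q1 := pow2_ge_0 (v al r)). assert (Q2 := pow2_ge_0 (u al r)). nra. }
  rewrite family_value_a, pow1 in H by lra.
  assert (N := family_value_1 al Hal).
  replace (dtn al) with ((u al 1 * v al 1) * / (u al 1) ^ 2) by (unfold dtn; field; exact N).
  apply Rmult_le_pos; [lra|]. left. apply Rinv_0_lt_compat.
  rewrite <- Rsqr_pow2. now apply Rsqr_pos_lt.
Qed.

(** Backward uniqueness: [(u^2 + u'^2) exp (K r)] is nondecreasing for large [K],
    so zero Cauchy data at [1] would force zero Cauchy data at [a]. *)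
Lemma critical_slope_nonzero : v L 1 <> 0.
Proof.
  intros H1.
  assert (HL := family_solution L (Rle_refl L)).
  set (K := 1 + Rabs L + 2 * (INR n / a)).
  assert (Hn := pos_INR n).
  assert (H : (u L a ^ 2 + v L a ^ 2) * exp (K * a) <= (u L 1 ^ 2 + v L 1 ^ 2) * exp (K * 1)).
  { apply (deriv_nonneg_le (fun r => (u L r ^ 2 + v L r ^ 2) * exp (K * r))
     (fun r => (2 * u L r * v L r + 2 * v L r * (- (INR n / r) * v L r - L * u L r)
                + K * (u L r ^ 2 + v L r ^ 2)) * exp (K * r))); [lra| |].
    - intros r Hr. destruct (HL r Hr) as [A B].
      auto_derive; [repeat split; eexists; eassumption|].
      rewrite (is_derive_unique (fun x0 : R => u L x0) _ _ A).
      rewrite (is_derive_unique (fun x0 : R => v L x0) _ _ B).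
      ring.
    - intros r Hr. apply Rmult_le_pos; [|left; apply exp_pos].
      assert (Hr' : INR n / r <= INR n / a).
      { apply Rmult_le_compat_l; [exact Hn|]. apply Rinv_le_contravar; lra. }
      assert (Q2 : 2 * L * (u L r * v L r) <= Rabs L * (u L r ^ 2 + v L r ^ 2)).
      { assert (A := Rle_abs L). assert (A' := Rle_abs (- L)). rewrite Rabs_Ropp in A'.
        assert (B1 := pow2_ge_0 (u L r + v L r)). assert (B2 := pow2_ge_0 (u L r - v L r)).
        nra. }
      assert (B1 := pow2_ge_0 (u L r + v L r)).
      assert (B2 := pow2_ge_0 (u L r)). assert (B3 := pow2_ge_0 (v L r)).
      assert (0 <= INR n / a) by (apply Rdiv_le_0_compat; lra).
      unfold K. nra. }
  rewrite family_value_1_critical, H1, family_value_a, family_slope_a in H by lra.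
  assert (P := exp_pos (K * a)).
  replace ((0 ^ 2 + 0 ^ 2) * exp (K * 1)) with 0 in H by ring. lra.
Qed.

Lemma dtn_unbounded_below (M : R) : exists al, al < L /\ dtn al < - M.
Proof.
  (* If [dtn >= - M], then [|dtn| <= K] on [(L - 1, L)] by monotonicity, and
     [|v L 1| <= (K C + C) t] for every small [t], with [C] a Lipschitz constant
     at [L]. *)
  apply NNPP. intros Hno.
  assert (Hge : forall al, al < L -> - M <= dtn al).
  { intros al Hal. apply Rnot_lt_le. intros Hlt. apply Hno. now exists al. }
  destruct (family_lipschitz L) as [C [HC H]]; [lra|].
  set (K := Rabs M + Rabs (dtn (L - 1))).
  assert (HK : forall al, L - 1 < al < L -> Rabs (dtn al) <= K).
  { intros al Hal. specialize (Hge al ltac:(lra)).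
    assert (D := dtn_decreasing (L - 1) al ltac:(lra) ltac:(lra)).
    unfold K. assert (A := Rle_abs M). assert (B := Rle_abs (dtn (L - 1))).
    assert (A' := Rabs_pos M). assert (B' := Rabs_pos (dtn (L - 1))).
    apply Rabs_le. lra. }
  assert (HK0 : 0 <= K) by (apply Rplus_le_le_0_compat; apply Rabs_pos).
  assert (Hv : forall t, 0 < t < 1 -> Rabs (v L 1) <= (K * C + C) * t).
  { intros t Ht. set (al := L - t).
    destruct (H al ltac:(unfold al; lra)
      ltac:(unfold al; rewrite Rabs_left; lra) 1 ltac:(lra)) as [E1 E2].
    replace (Rabs (al - L)) with t in E1, E2 by (unfold al; rewrite Rabs_left; lra).
    rewrite family_value_1_critical, Rminus_0_r in E1.
    specialize (HK al ltac:(unfold al; lra)).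
    assert (E3 : v al 1 = dtn al * u al 1).
    { unfold dtn. field. apply family_value_1. unfold al; lra. }
    assert (E4 : Rabs (v al 1) <= K * (C * t)).
    { rewrite E3, Rabs_mult. apply Rmult_le_compat; try apply Rabs_pos; assumption. }
    replace (v L 1) with (v al 1 - (v al 1 - v L 1)) by ring.
    eapply Rle_trans; [apply Rabs_triang|]. rewrite Rabs_Ropp. lra. }
  assert (Hpos := Rabs_pos_lt _ critical_slope_nonzero).
  set (D := K * C + C) in Hv.
  assert (HD : 0 <= D) by (unfold D; assert (0 <= K * C) by (apply Rmult_le_pos; lra); lra).
  set (w := Rabs (v L 1)) in *.
  (* The choice [t = w / (D + w + 1)] gives [w (w + 1) <= 0], against [0 < w]. *)
  assert (Hden : 0 < D + w + 1) by lra.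
  specialize (Hv (w / (D + w + 1))).
  assert (Hq : 0 < w / (D + w + 1) < 1).
  { split; [apply Rdiv_lt_0_compat; lra|]. apply Rmult_lt_reg_r with (D + w + 1); [lra|].
    unfold Rdiv. rewrite Rmult_assoc, Rinv_l by lra. lra. }
  specialize (Hv Hq).
  apply (Rmult_le_compat_r (D + w + 1)) in Hv; [|lra].
  replace (D * (w / (D + w + 1)) * (D + w + 1)) with (D * w) in Hv by (field; lra).
  nra.
Qed.

(** Intermediate values between a nonpositive parameter, where the function is
    nonnegative, and a parameter close to [L], where it is below [- M]. *)
Lemma dtn_attains (M : R) : 0 < M -> exists al, al < L /\ dtn al = - M.
Proof.
  intros HM.
  destruct (dtn_unbounded_below M) as [be [Hbe Hlt]].
  set (g := Rmin 0 L - 1).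
  assert (G1 : Rmin 0 L <= 0) by apply Rmin_l. assert (G2 : Rmin 0 L <= L) by apply Rmin_r.
  assert (Hg : 0 <= dtn g) by (apply dtn_nonneg; unfold g; lra).
  assert (Hgb : g < be).
  { destruct (Rlt_le_dec g be) as [H|H]; [exact H|exfalso].
    destruct H as [H|H]; [|rewrite H in Hlt; lra].
    assert (D := dtn_decreasing be g H ltac:(unfold g; lra)). lra. }
  destruct (IVT_interv (fun al => - M - dtn al) g be) as [al [Hal E]]; try lra.
  - intros al Hal. destruct (dtn_decreasing_derivative al) as [d [_ Hd]]; [lra|].
    apply continuity_pt_minus; [apply continuity_pt_const; intros s t; reflexivity|].
    exact (is_derive_continuity_pt _ _ _ Hd).
  - exists al. split; lra.
Qed.

End DirichletNeumann.

(** * Boundary value problems *)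

Lemma solves_c_extension (N : nat) (a al b : R) (c : R -> R) :
  (1 <= N)%nat -> a < 1 -> solves_c N a al b c ->
  exists y z, radial_solution a (INR (N - 1)) al y z /\
    forall r, ival a r -> y r = c r /\ z r = der a c r.
Proof.
  intros HN Ha (Hd & Hdd & Hode & _ & _).
  destruct (diff_on_extension a c Ha Hd) as [y Hy].
  destruct (diff_on_extension a _ Ha Hdd) as [z Hz].
  exists y, z. split.
  - intros r Hr. destruct (Hy r Hr) as [Y1 Y2], (Hz r Hr) as [Z1 Z2].
    specialize (Hode r Hr). split; [now rewrite Z1|].
    rewrite minus_INR, Y1, Z1 by exact HN. simpl INR.
    replace (- ((INR N - 1) / r) * der a c r - al * c r) with (der a (der a c) r) by lra.
    exact Z2.
  - intros r Hr. split; [apply (Hy r Hr)|apply (Hz r Hr)].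
Qed.

(** The eigenvalue equation is given on the open interval only; continuity of
    its right-hand side extends it to the endpoints. *)
Lemma eigenfunction_extension (N : nat) (a lam : R) (phi : R -> R) :
  0 < a < 1 -> is_eigenfunction N a lam phi ->
  exists y z, radial_solution a (INR (N - 1)) lam y z /\
    forall r, ival a r -> y r = phi r /\ z r = der a phi r.
Proof.
  intros Ha (Hd & Hdd & Hode & _).
  destruct (diff_on_extension a phi ltac:(lra) Hd) as [y Hy].
  destruct (diff_on_extension a _ ltac:(lra) Hdd) as [G HG]. cbv beta in HG.
  set (n := (N - 1)%nat) in *.
  assert (Hpow : forall r, a <= r -> 0 < r ^ n) by (intros; apply pow_lt; lra).
  assert (HG' : forall r, a <= r <= 1 ->
    der a (fun s => s ^ n * der a phi s) r = - lam * (r ^ n * y r)).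
  { apply (derivative_closed_interval G); [lra|intros; now apply HG| |].
    - intros r Hr. rewrite (proj1 (Hy r ltac:(unfold ival; lra))).
      specialize (Hode r Hr). lra.
    - intros r Hr. apply continuity_pt_mult; [apply continuity_pt_const; intros s t; reflexivity|].
      apply continuity_pt_mult.
      + eapply is_derive_continuity_pt, is_derive_weight. lra.
      + eapply is_derive_continuity_pt, (proj2 (Hy r Hr)). }
  assert (Hz : forall r, ival a r -> G r / r ^ n = der a phi r).
  { intros r Hr. rewrite (proj1 (HG r Hr)). field.
    specialize (Hpow r (proj1 Hr)). lra. }
  exists y, (fun r => G r / r ^ n). split.
  - intros r Hr. split; [rewrite Hz by exact Hr; apply (Hy r Hr)|].
    specialize (Hpow r (proj1 Hr)).
    assert (D1 := proj2 (HG r Hr)). rewrite HG' in D1 by exact Hr.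
    assert (D2 := is_derive_weight n r ltac:(lra)).
    assert (D := is_derive_div _ _ _ _ _ D1 D2 ltac:(lra)).
    match type of D with is_derive _ _ ?l =>
      replace (- (INR n / r) * (G r / r ^ n) - lam * y r) with l end; [exact D|].
    field. lra.
  - intros r Hr. split; [apply (Hy r Hr)|now apply Hz].
Qed.

Lemma radial_solution_eigenvalue (N : nat) (a al : R) (y z : R -> R) :
  0 < a < 1 -> radial_solution a (INR (N - 1)) al y z ->
  y a = 0 -> y 1 = 0 -> (exists r, ival a r /\ y r <> 0) -> is_eigenvalue N a al.
Proof.
  intros Ha Hs Ya Y1 Hne.
  set (n := (N - 1)%nat) in *.
  assert (Hz : forall r, ival a r -> der a y r = z r).
  { intros r Hr. apply (der_is_derive a r _ y y); [lra|exact Hr|reflexivity|now apply Hs]. }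
  assert (HP : forall r, ival a r -> is_derive (fun s => s ^ n * z s) r (- al * r ^ n * y r)).
  { intros r Hr. destruct (Hs r Hr) as [A B]. destruct Hr as [Hr1 Hr2].
    assert (P := is_derive_weight n r ltac:(lra)).
    apply is_derive_Reals in B, P. apply is_derive_Reals.
    assert (D := derivable_pt_lim_mult _ _ _ _ _ P B). unfold mult_fct in D.
    match type of D with derivable_pt_lim _ _ ?l =>
      replace (- al * r ^ n * y r) with l end; [exact D|].
    field. lra. }
  assert (Hext : forall s, ival a s -> s ^ n * z s = s ^ n * der a y s).
  { intros s Hs'. now rewrite Hz. }
  exists y. unfold is_eigenfunction. fold n. repeat split; try assumption.
  - intros r Hr. exists (z r). apply (is_derive_D_in a r _ y y); [exact Hr|reflexivity|now apply Hs].
  - intros r Hr. eexists. eapply is_derive_D_in; [exact Hr|exact Hext|now apply HP].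
  - intros r Hr. assert (Hr' : ival a r) by (unfold ival; lra).
    rewrite (der_is_derive a r _ _ _ ltac:(lra) Hr' Hext (HP r Hr')). ring.
Qed.

(** Off the spectrum a radial solution is determined by its boundary values: the
    difference of two such solutions would otherwise be an eigenfunction. *)
Lemma dirichlet_slope_unique (N : nat) (a al : R) (y1 z1 y2 z2 : R -> R) :
  0 < a < 1 -> ~ is_eigenvalue N a al ->
  radial_solution a (INR (N - 1)) al y1 z1 -> radial_solution a (INR (N - 1)) al y2 z2 ->
  y1 a = 0 -> y2 a = 0 -> y1 1 = y2 1 -> z1 1 = z2 1.
Proof.
  intros Ha Hne H1 H2 A1 A2 B.
  assert (Hs := radial_solution_lin _ _ _ 1 (-1) _ _ _ _ H1 H2).
  assert (H0 : forall r, ival a r -> 1 * y1 r + -1 * y2 r = 0).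
  { intros r Hr. destruct (Req_dec (1 * y1 r + -1 * y2 r) 0) as [E|E]; [exact E|].
    exfalso. apply Hne. eapply radial_solution_eigenvalue; [exact Ha|exact Hs| | |].
    - cbv beta. rewrite A1, A2. ring.
    - cbv beta. rewrite B. ring.
    - now exists r. }
  assert (I1 : ival a 1) by (unfold ival; lra).
  assert (D1 := der_is_derive a 1 _ (fun _ => 0) _ ltac:(lra) I1 H0 (proj1 (Hs 1 I1))).
  assert (D2 := der_is_derive a 1 _ (fun _ => 0) (fun _ => 0) ltac:(lra) I1 (fun _ _ => eq_refl)
                  (is_derive_const 0 1)).
  unfold zero in D2; simpl in D2. lra.
Qed.

(** * The spectral parameter as a function of the period *)

(** A period lies in the spectral gap exactly when [alpha_1] is below the first
    eigenvalue. *)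
Lemma in_gap_iff (lam : nat -> R) (k : nat) (T : R) :
  (1 <= k)%nat -> (k = 1%nat \/ lam 1%nat < lam k) ->
  in_gap lam k T <-> 0 < T /\ alpha lam k 1 T < lam 1%nat.
Proof.
  intros Hk Hlt. unfold in_gap, alpha. simpl INR. rewrite Rmult_1_r.
  assert (HPI := PI_RGT_0).
  assert (Hsq : 0 < T -> 0 < (2 * PI / T)).
  { intros HT. apply Rdiv_lt_0_compat; lra. }
  destruct k as [|[|k]]; [lia| |].
  - simpl T_hat. simpl Rbar_lt. split; intros [HT _]; split; try exact HT; try exact I.
    specialize (Hsq HT). nra.
  - destruct Hlt as [?|Hlt]; [lia|]. simpl T_hat. simpl Rbar_lt.
    set (D := lam (S (S k)) - lam 1%nat).
    assert (HD : 0 < D) by (unfold D; lra).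
    assert (Hs := sqrt_lt_R0 D HD). assert (Hss := sqrt_sqrt D (Rlt_le _ _ HD)).
    set (s := sqrt D) in *.
    assert (E : forall T, 0 < T -> T < 2 * PI / s <-> s < 2 * PI / T).
    { intros t Ht. split; intros H.
      - apply Rmult_lt_reg_r with t; [exact Ht|].
        apply (Rmult_lt_compat_r s) in H; [|exact Hs].
        replace (2 * PI / t * t) with (2 * PI) by (field; lra).
        replace (2 * PI / s * s) with (2 * PI) in H by (field; lra). lra.
      - apply Rmult_lt_reg_r with s; [exact Hs|].
        apply (Rmult_lt_compat_r t) in H; [|exact Ht].
        replace (2 * PI / t * t) with (2 * PI) in H by (field; lra).
        replace (2 * PI / s * s) with (2 * PI) by (field; lra). lra. }
    split; intros [HT H]; split; try exact HT; specialize (Hsq HT).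
    + apply E in H; [|exact HT]. unfold D in *. nra.
    + apply E; [exact HT|]. assert (s * s < (2 * PI / T) ^ 2) by (unfold D in *; lra). nra.
Qed.

Lemma alpha_decreasing_in_m (lam : nat -> R) (k m : nat) (T : R) :
  0 < T -> (2 <= m)%nat -> alpha lam k m T < alpha lam k 1 T.
Proof.
  intros HT Hm. unfold alpha. apply le_INR in Hm. simpl INR in Hm.
  assert (H := Rdiv_lt_0_compat _ _ PI_RGT_0 HT).
  replace (2 * INR m * PI / T) with (2 * INR m * (PI / T)) by (field; lra).
  replace (2 * INR 1 * PI / T) with (2 * (PI / T)) by (simpl; field; lra).
  set (x := PI / T) in *. clearbody x.
  assert (2 * x < 2 * INR m * x) by nra. nra.
Qed.

Lemma alpha_inverse (lam : nat -> R) (k : nat) (al : R) :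
  al < lam k -> 0 < 2 * PI / sqrt (lam k - al) /\
    alpha lam k 1 (2 * PI / sqrt (lam k - al)) = al.
Proof.
  intros H. assert (Hs := sqrt_lt_R0 (lam k - al) ltac:(lra)).
  assert (Hss := sqrt_sqrt (lam k - al) ltac:(lra)).
  assert (HPI := PI_RGT_0).
  split; [apply Rdiv_lt_0_compat; lra|].
  unfold alpha. simpl INR.
  replace (2 * 1 * PI / (2 * PI / sqrt (lam k - al))) with (sqrt (lam k - al)) by (field; lra).
  simpl. rewrite Rmult_1_r, Hss. ring.
Qed.

Lemma alpha_injective (lam : nat -> R) (k : nat) (T T' : R) :
  0 < T -> 0 < T' -> alpha lam k 1 T = alpha lam k 1 T' -> T = T'.
Proof.
  intros HT HT' E. unfold alpha in E. simpl INR in E. rewrite Rmult_1_r in E.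
  assert (HPI := PI_RGT_0).
  assert (H : 2 * PI / T = 2 * PI / T').
  { assert (P1 := Rdiv_lt_0_compat (2 * PI) T ltac:(lra) HT).
    assert (P2 := Rdiv_lt_0_compat (2 * PI) T' ltac:(lra) HT'). nra. }
  apply Rmult_eq_reg_l in H; [|lra].
  now apply Rinv_eq_reg.
Qed.

Lemma is_derive_alpha (lam : nat -> R) (k : nat) (T : R) :
  0 < T -> exists d, 0 < d /\ is_derive (alpha lam k 1) T d.
Proof.
  intros HT. exists (8 * PI ^ 2 / T ^ 3). split.
  - apply Rdiv_lt_0_compat; [|now apply pow_lt].
    assert (Q := pow_lt PI 2 PI_RGT_0). lra.
  - unfold alpha. simpl INR. auto_derive; [lra|]. field. lra.
Qed.

(** * The zero of the first symbol *)

Theorem mainTheorem3 :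
  forall (R0 : R) (N k : nat),
  0 < R0 < 1 -> (2 <= N)%nat -> (1 <= k)%nat ->
  forall lam : nat -> R, is_spectrum N R0 lam ->
  forall phi : R -> R, is_normalized_eigenfunction N R0 (lam k) phi ->
  forall c : nat -> R -> R -> R,
  (forall (m : nat) (T : R), (1 <= m)%nat -> in_gap lam k T ->
     solves_c N R0 (alpha lam k m T) (- der R0 phi 1) (c m T)) ->
  exists Tstar : R,
    in_gap lam k Tstar /\
    Sigma R0 phi c 1 Tstar = 0 /\
    (forall T : R, in_gap lam k T -> Sigma R0 phi c 1 T = 0 -> T = Tstar) /\
    (ex_derive (Sigma R0 phi c 1) Tstar /\
     Derive (Sigma R0 phi c 1) Tstar <> 0) /\
    (forall m : nat, (2 <= m)%nat -> Sigma R0 phi c m Tstar <> 0).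
Proof.
  intros a N k Ha HN Hk lam [Hinc Hspec] phi [Hphi [_ Hslope]] c Hc.
  set (b := - der a phi 1) in Hc. assert (Hb : 0 < b) by (unfold b; lra).
  set (n := (N - 1)%nat). assert (Hn : 0 < INR n) by (apply lt_0_INR; unfold n; lia).
  assert (I1 : ival a 1) by (unfold ival; lra).
  set (L := lam 1%nat).
  assert (HL : forall j, (1 <= j)%nat -> j = 1%nat \/ L < lam j).
  { intros j Hj. destruct (Nat.eq_dec j 1) as [?|?]; [now left|right].
    apply Hinc; lia. }
  assert (HLk : L <= lam k) by (destruct (HL k Hk) as [->|?]; unfold L in *; lra).
  assert (Hgap : forall T, in_gap lam k T <-> 0 < T /\ alpha lam k 1 T < L).
  { intros T. apply in_gap_iff; [exact Hk|exact (HL k Hk)]. }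
  assert (Hregular : forall al, al < L -> ~ is_eigenvalue N a al).
  { intros al Hal He. apply Hspec in He. destruct He as [j [Hj ->]].
    destruct (HL j Hj) as [->|?]; unfold L in *; lra. }
  (* The equation of [phi] at [r = 1], where [phi] vanishes. *)
  assert (Hphi2 : der a (der a phi) 1 = INR n * b).
  { destruct (eigenfunction_extension N a (lam k) phi Ha Hphi) as (y & z & Hs & E).
    rewrite (der_is_derive a 1 _ (der a phi) z ltac:(lra) I1
               (fun s Hs' => proj2 (E s Hs')) (proj2 (Hs 1 I1))).
    destruct (E 1 I1) as [E1 E2]. rewrite E1, E2.
    destruct Hphi as (_ & _ & _ & _ & -> & _). fold n. unfold b. field. }
  (* Below [L] the given solutions [c 1 T] provide the shooting family; at [L]
     an eigenfunction does. *)
  destruct (shooting_family_exists a n L Ha) as (u & v & Huv).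
  { intros al Hal. destruct (Rle_lt_or_eq_dec al L Hal) as [Hlt|Heq].
    - destruct (alpha_inverse lam k al ltac:(lra)) as [HT Ha1].
      set (T := 2 * PI / sqrt (lam k - al)) in *.
      assert (HTg : in_gap lam k T) by (apply Hgap; lra).
      specialize (Hc 1%nat T (le_n 1) HTg). rewrite Ha1 in Hc.
      destruct (solves_c_extension N a al b _ ltac:(lia) ltac:(lra) Hc) as (y & z & Hs & E).
      destruct Hc as (_ & _ & _ & C0 & C1).
      assert (Y1 : y 1 = b) by (rewrite (proj1 (E 1 I1)); exact C1).
      exists y, z. split; [exact Hs|].
      split; [now rewrite (proj1 (E a ltac:(unfold ival; lra)))|].
      split; [exists 1; lra|]. split; lra.
    - subst al.
      destruct (proj2 (Hspec L)) as [psi Hpsi]; [exists 1%nat; now split|].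
      destruct (eigenfunction_extension N a L psi Ha Hpsi) as (y & z & Hs & E).
      destruct Hpsi as (_ & _ & _ & C0 & C1 & [r [Hr Hne]]).
      exists y, z. split; [exact Hs|].
      split; [now rewrite (proj1 (E a ltac:(unfold ival; lra)))|].
      split; [exists r; split; [exact Hr|now rewrite (proj1 (E r Hr))]|].
      split; [lra|]. intros _. now rewrite (proj1 (E 1 I1)). }
  assert (Hfam := Huv). destruct Hfam as (Hsol & Hu0 & _ & Hu1 & _).
  set (s := dtn u v).
  assert (Hsigma : forall m T, (1 <= m)%nat -> in_gap lam k T ->
    Sigma a phi c m T = b * s (alpha lam k m T) + INR n * b).
  { intros m T Hm HT. unfold Sigma. rewrite Hphi2. f_equal.
    assert (Hal : alpha lam k m T < L).
    { destruct (proj1 (Hgap T) HT) as [HT0 HT1].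
      destruct (Nat.eq_dec m 1) as [->|?]; [exact HT1|].
      apply Rlt_trans with (alpha lam k 1 T); [|exact HT1].
      apply alpha_decreasing_in_m; [exact HT0|lia]. }
    specialize (Hc m T Hm HT). set (al := alpha lam k m T) in *.
    destruct (solves_c_extension N a al b _ ltac:(lia) ltac:(lra) Hc) as (y & z & Hs & E).
    destruct Hc as (_ & _ & _ & C0 & C1).
    rewrite <- (proj2 (E 1 I1)).
    assert (Hu := Hu1 al Hal).
    assert (Hs2 := radial_solution_lin _ _ _ (b / u al 1) 0 _ _ _ _
      (Hsol al ltac:(lra)) (Hsol al ltac:(lra))).
    rewrite (dirichlet_slope_unique N a al _ _ _ _ Ha (Hregular al Hal) Hs Hs2).
    - unfold s, dtn. field. exact Hu.
    - rewrite (proj1 (E a ltac:(unfold ival; lra))). exact C0.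
    - rewrite Hu0 by lra. ring.
    - rewrite (proj1 (E 1 I1)), C1. field. exact Hu. }
  assert (Hdec : forall al be, al < be -> be < L -> s be < s al).
  { exact (dtn_decreasing a n L u v Ha Huv). }
  destruct (dtn_attains a n L u v Ha Huv (INR n) Hn) as [als [Hals Es]].
  fold s in Es.
  destruct (alpha_inverse lam k als ltac:(lra)) as [HT Ha1].
  set (Ts := 2 * PI / sqrt (lam k - als)) in *.
  assert (HTs : in_gap lam k Ts) by (apply Hgap; lra).
  exists Ts. split; [exact HTs|]. split; [|split; [|split]].
  - rewrite Hsigma, Ha1, Es by (lia || exact HTs). ring.
  - intros T HTg E. rewrite Hsigma in E by (lia || exact HTg).
    destruct (proj1 (Hgap T) HTg) as [HT0 HT1].
    apply (alpha_injective lam k); [exact HT0|exact HT|]. rewrite Ha1.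
    destruct (Rtotal_order (alpha lam k 1 T) als) as [H|[H|H]]; [|exact H|].
    + specialize (Hdec _ _ H Hals). nra.
    + specialize (Hdec _ _ H HT1). nra.
  - destruct (dtn_decreasing_derivative a n L u v Ha Huv als Hals) as [d [Hd Hds]].
    destruct (is_derive_alpha lam k Ts HT) as [d' [Hd' Hda]].
    assert (D : is_derive (Sigma a phi c 1) Ts (b * (d' * d))).
    { apply (is_derive_ext_loc (fun T => b * s (alpha lam k 1 T) + INR n * b)).
      - assert (O1 : locally Ts (fun T => 0 < T)) by now apply open_gt.
        assert (O2 : locally Ts (fun T => alpha lam k 1 T < L)).
        { apply (ex_derive_continuous (alpha lam k 1) Ts (ex_intro _ d' Hda) (fun t => t < L)).
          apply open_lt. now rewrite Ha1. }
        generalize (filter_and _ _ O1 O2). apply filter_imp. intros T HT'.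
        symmetry. apply Hsigma; [lia|now apply Hgap].
      - rewrite <- (Rplus_0_r (b * (d' * d))).
        apply (is_derive_plus (fun T => b * s (alpha lam k 1 T)) (fun _ => INR n * b));
          [|exact (is_derive_const (INR n * b) Ts)].
        apply is_derive_scal.
        apply (is_derive_comp s (alpha lam k 1)); [now rewrite Ha1|exact Hda]. }
    split; [eexists; exact D|]. rewrite (is_derive_unique _ _ _ D).
    assert (b * (d' * - d) > 0) by (apply Rmult_lt_0_compat; [|apply Rmult_lt_0_compat]; lra).
    lra.
  - intros m Hm. rewrite Hsigma by (lia || exact HTs).
    assert (H := alpha_decreasing_in_m lam k m Ts HT Hm). rewrite Ha1 in H.
    specialize (Hdec _ _ H Hals). nra.
Qed.
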